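(* Let $R$ be a four-sided convex polygon in the $xy$ plane and let $M_1$ and $M_2$ be the midpoints of the diagonals of $R$. Let $Z$ be the open line segment connecting $M_1$ and $M_2$. If $(h,k)\in Z$, then there is a unique ellipse with center $(h,k)$ inscribed in $R$.
   Context: An ellipse is said to be inscribed in a four-sided convex polygon $R$ if the ellipse lies inside $R$ and is tangent to each side of $R$. *)

(* Defs.v *)
From Stdlib Require Import Reals Lra.
From Coquelicot Require Import Coquelicot.
Open Scope R_scope.

Definition point : Type := (R * R)%type.
Definition pset : Type := point -> Prop.

Definition midpoint (P Q : point) : point :=
  ((fst P + fst Q) / 2, (snd P + snd Q) / 2).

Definition segment (P Q : point) : pset := fun X =>
  exists t : R, 0 <= t <= 1 /\
    X = ((1 - t) * fst P + t * fst Q, (1 - t) * snd P + t * snd Q).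

(** Empty when [P = Q], unlike the set of convex combinations of [P] and [Q]
    with both weights positive. *)
Definition open_segment (P Q : point) : pset := fun X =>
  segment P Q X /\ X <> P /\ X <> Q.

(** Twice the signed area of the triangle [P Q X]; its sign tells on which side
    of the line [PQ] the point [X] lies. *)
Definition orient (P Q X : point) : R :=
  (fst Q - fst P) * (snd X - snd P) - (snd Q - snd P) * (fst X - fst P).

Definition strictly_same_side (P Q X Y : point) : Prop :=
  0 < orient P Q X * orient P Q Y.

(** The vertices are listed in cyclic order, so the sides are [AB], [BC], [CD],
    [DA] and the diagonals are [AC], [BD].  Strictness excludes repeated
    vertices and straight angles, so that there are exactly four sides. *)
Definition convex_quadrilateral (A B C D : point) : Prop :=
  strictly_same_side A B C D /\ strictly_same_side B C D A /\
  strictly_same_side C D A B /\ strictly_same_side D A B C.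

Definition hull4 (A B C D : point) : pset := fun X =>
  exists a b c d : R,
    0 <= a /\ 0 <= b /\ 0 <= c /\ 0 <= d /\ a + b + c + d = 1 /\
    X = (a * fst A + b * fst B + c * fst C + d * fst D,
         a * snd A + b * snd B + c * snd C + d * snd D).

(** The curve [x^2 / p^2 + y^2 / q^2 = 1] in the orthonormal frame with origin
    [O] and axes [(u1, u2)], [(- u2, u1)]; a circle counts as an ellipse. *)
Definition ellipse_curve (O : point) (u1 u2 p q : R) : pset := fun X =>
  let x := u1 * (fst X - fst O) + u2 * (snd X - snd O) in
  let y := - u2 * (fst X - fst O) + u1 * (snd X - snd O) in
  x ^ 2 / p ^ 2 + y ^ 2 / q ^ 2 = 1.

Definition ellipse_with_center (O : point) (E : pset) : Prop :=
  exists u1 u2 p q : R, u1 ^ 2 + u2 ^ 2 = 1 /\ 0 < p /\ 0 < q /\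
    E = ellipse_curve O u1 u2 p q.

(** [v] is the velocity at [P] of a curve running inside [E]. *)
Definition tangent_vector (E : pset) (P v : point) : Prop :=
  exists g : R -> point, g 0 = P /\ locally 0 (fun t => E (g t)) /\
    is_derive (fun t => fst (g t)) 0 (fst v) /\
    is_derive (fun t => snd (g t)) 0 (snd v).

(** For [P <> Q]: at some point of the side [PQ], the line [PQ] is tangent
    to [E]. *)
Definition tangent_to_side (E : pset) (P Q : point) : Prop :=
  exists T : point, segment P Q T /\ E T /\
    tangent_vector E T (fst Q - fst P, snd Q - snd P).

Definition inscribed (E : pset) (A B C D : point) : Prop :=
  (forall X : point, E X -> hull4 A B C D X) /\
  tangent_to_side E A B /\ tangent_to_side E B C /\
  tangent_to_side E C D /\ tangent_to_side E D A.

(* Main.v *)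
Require Import Defs.
From Stdlib Require Import Reals Lra FunctionalExtensionality PropExtensionality.
From Coquelicot Require Import Coquelicot.
Open Scope R_scope.

(** An ellipse with center [O] is a curve [m (X - O) = 1] for a positive definite
    binary quadratic form [m].  Put [m* = m / det m]; up to a quarter turn this is
    the inverse matrix of [m], so [m* v] is the squared support function of the
    ellipse in the direction normal to [v], and [m** = m].  Lagrange's identity
    [m x * m v - m (x, v) ^ 2 = det m * (x * v) ^ 2], where the last product is the
    cross product, shows that the line [PQ] is tangent to the ellipse iff
    [m* (Q - P) = (orient P Q O) ^ 2] ([dual_of_tangent], [tangent_of_dual]).
    Tangency to the four sides is thus a system of four equations that are linear
    in the three coefficients of [m*].

    Uniqueness: two solutions differ by a binary quadratic form that vanishes on
    the four side vectors.  If the midpoints of the diagonals differ, then the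
    quadrilateral is not a parallelogram, so three of the side vectors are pairwise
    non-parallel, and a binary quadratic form with three distinct zeros is zero
    ([form_eq_on_sides]).

    Existence: the dual conics tangent to the four sides form the pencil spanned by
    the two degenerate ones, the pairs of opposite vertices [A, C] and [B, D].  In
    this pencil the conic with weights [1 - t] and [t] has its center at the point
    [O] of parameter [t] on the line through the two midpoints, and there
    [m* d = - (1 - t) (d * OA) (d * OC) - t (d * OB) (d * OD)] with cross products
    ([pencil], [pencil_side]).  Its determinant is a positive combination of
    products of areas of the triangles formed by the vertices ([det_pencil]), so
    [m] is positive definite.  Lagrange's identity then puts the ellipse on the
    inner side of every side line, hence in the quadrilateral; in particular each
    point of tangency lies on a side and not merely on the line that carries it. *)

(** * Binary quadratic forms *)

Record form : Type := Form { xx : R; xy : R; yy : R }.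

Definition bil (m : form) (v w : point) : R :=
  xx m * fst v * fst w + xy m * (fst v * snd w + snd v * fst w)
  + yy m * snd v * snd w.

Definition det (m : form) : R := xx m * yy m - xy m ^ 2.

Definition posdef (m : form) : Prop := 0 < xx m /\ 0 < det m.

Definition cross (v w : point) : R := fst v * snd w - snd v * fst w.

(** The inverse of the matrix of [m], conjugated by a quarter turn: [dual m] takes
    side vectors where the inverse matrix would take normal vectors. *)
Definition dual (m : form) : form :=
  Form (xx m / det m) (xy m / det m) (yy m / det m).

Lemma lagrange_identity (m : form) (v w : point) :
  bil m v v * bil m w w - bil m v w ^ 2 = det m * cross v w ^ 2.
Proof. unfold bil, det, cross; ring. Qed.

Lemma bil_dual (m : form) (v w : point) :
  bil (dual m) v w = bil m v w / det m.
Proof. unfold bil, dual, Rdiv; cbn; ring. Qed.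

Lemma det_dual (m : form) : det m <> 0 -> det (dual m) = / det m.
Proof.
  intro H.
  assert (E : det (dual m) = det m / (det m * det m)).
  { unfold dual at 1; unfold det at 1; cbn [xx xy yy].
    replace (det m / (det m * det m))
      with ((xx m * yy m - xy m ^ 2) / (det m * det m)) by reflexivity.
    field; exact H. }
  rewrite E; field; exact H.
Qed.

Lemma dual_involutive (m : form) : det m <> 0 -> dual (dual m) = m.
Proof.
  intro H; assert (E := det_dual m H).
  unfold dual at 1; rewrite E; cbn.
  destruct m as [a b c]; cbn in *; f_equal; field; exact H.
Qed.

Lemma posdef_dual (m : form) : posdef m -> posdef (dual m).
Proof.
  intros [Ha Hd]; split.
  - cbn; apply Rdiv_lt_0_compat; assumption.
  - rewrite det_dual by lra; apply Rinv_0_lt_compat; exact Hd.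
Qed.

Lemma bil_pos (m : form) (v : point) :
  posdef m -> v <> (0, 0) -> 0 < bil m v v.
Proof.
  destruct m as [a b c], v as [x y]; unfold posdef, det, bil; cbn.
  intros [Ha Hd] Hv.
  (* Completing the square. *)
  apply Rmult_lt_reg_l with a; [exact Ha|].
  replace (a * (a * x * x + b * (x * y + y * x) + c * y * y))
    with ((a * x + b * y) ^ 2 + (a * c - b * (b * 1)) * y ^ 2) by ring.
  rewrite Rmult_0_r.
  destruct (Req_dec y 0) as [->|Hy].
  - assert (Hx : x <> 0) by (intro; apply Hv; subst; reflexivity).
    assert (0 < (a * x) ^ 2)
      by (apply pow2_gt_0; apply Rmult_integral_contrapositive; lra).
    replace (a * x + b * 0) with (a * x) by ring; lra.
  - assert (0 < (a * c - b * (b * 1)) * y ^ 2)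
      by (apply Rmult_lt_0_compat; [exact Hd | apply pow2_gt_0; exact Hy]).
    assert (0 <= (a * x + b * y) ^ 2) by apply pow2_ge_0; lra.
Qed.

Lemma posdef_of_value (m : form) (v : point) :
  0 < det m -> 0 < bil m v v -> posdef m.
Proof.
  destruct m as [a b c], v as [x y]; unfold posdef, det, bil; cbn.
  intros Hd Hv; split; [|exact Hd].
  assert (Hac : 0 < a * c) by nra.
  (* A form with positive determinant is definite, and [v] fixes its sign. *)
  assert (H : 0 <= a * (a * x * x + b * (x * y + y * x) + c * y * y)).
  { replace (a * (a * x * x + b * (x * y + y * x) + c * y * y))
      with ((a * x + b * y) ^ 2 + (a * c - b * (b * 1)) * y ^ 2) by ring.
    apply Rplus_le_le_0_compat; [apply pow2_ge_0|].
    apply Rmult_le_pos; [lra | apply pow2_ge_0]. }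
  destruct (Rtotal_order a 0) as [Ha|[Ha|Ha]]; [nra | subst; lra | exact Ha].
Qed.

(** The Vandermonde determinant of the three zeros, in homogeneous coordinates, is
    the product of the three cross products; Cramer's rule for it gives the
    identities below. *)
Lemma form_eq_on_three (m n : form) (u v w : point) :
  cross u v <> 0 -> cross v w <> 0 -> cross u w <> 0 ->
  bil m u u = bil n u u -> bil m v v = bil n v v -> bil m w w = bil n w w ->
  m = n.
Proof.
  destruct m as [a b c], n as [a' b' c'], u as [u1 u2], v as [v1 v2], w as [w1 w2].
  unfold cross, bil; cbn; intros Huv Hvw Huw Hu Hv Hw.
  set (p := u1 * v2 - u2 * v1) in *.
  set (q := v1 * w2 - v2 * w1) in *.
  set (r := u1 * w2 - u2 * w1) in *.
  assert (Hk : p * q * r <> 0)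
    by (repeat apply Rmult_integral_contrapositive_currified; assumption).
  assert (Cancel : forall x y, (x - y) * (p * q * r) = 0 -> x = y).
  { intros x y H; apply Rmult_integral in H; lra. }
  set (fu := (a - a') * u1 * u1 + (b - b') * (u1 * u2 + u2 * u1) + (c - c') * u2 * u2).
  set (fv := (a - a') * v1 * v1 + (b - b') * (v1 * v2 + v2 * v1) + (c - c') * v2 * v2).
  set (fw := (a - a') * w1 * w1 + (b - b') * (w1 * w2 + w2 * w1) + (c - c') * w2 * w2).
  assert (Fu : fu = 0) by (unfold fu; lra).
  assert (Fv : fv = 0) by (unfold fv; lra).
  assert (Fw : fw = 0) by (unfold fw; lra).
  f_equal; apply Cancel.
  - transitivity (fu * (v2 * w2 * q) - fv * (u2 * w2 * r) + fw * (u2 * v2 * p)).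
    + unfold fu, fv, fw, p, q, r; ring.
    + rewrite Fu, Fv, Fw; ring.
  - transitivity (- (fu * ((v1 * w2 + v2 * w1) / 2 * q)
      - fv * ((u1 * w2 + u2 * w1) / 2 * r) + fw * ((u1 * v2 + u2 * v1) / 2 * p))).
    + unfold fu, fv, fw, p, q, r; field.
    + rewrite Fu, Fv, Fw; ring.
  - transitivity (fu * (v1 * w1 * q) - fv * (u1 * w1 * r) + fw * (u1 * v1 * p)).
    + unfold fu, fv, fw, p, q, r; ring.
    + rewrite Fu, Fv, Fw; ring.
Qed.

(** * Ellipses as level curves of positive definite forms *)

Definition vec (P Q : point) : point := (fst Q - fst P, snd Q - snd P).

Definition conic (m : form) (O : point) : pset := fun X =>
  bil m (vec O X) (vec O X) = 1.

Lemma pset_ext (E F : pset) : (forall X, E X <-> F X) -> E = F.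
Proof.
  intro H; apply functional_extensionality; intro X.
  apply propositional_extensionality, H.
Qed.

Lemma conic_of_ellipse (O : point) (E : pset) :
  ellipse_with_center O E -> exists m, posdef m /\ E = conic m O.
Proof.
  intros (u1 & u2 & p & q & Hu & Hp & Hq & ->).
  exists (Form (u1 ^ 2 / p ^ 2 + u2 ^ 2 / q ^ 2) (u1 * u2 / p ^ 2 - u1 * u2 / q ^ 2)
               (u2 ^ 2 / p ^ 2 + u1 ^ 2 / q ^ 2)).
  assert (Hd : det (Form (u1 ^ 2 / p ^ 2 + u2 ^ 2 / q ^ 2)
      (u1 * u2 / p ^ 2 - u1 * u2 / q ^ 2) (u2 ^ 2 / p ^ 2 + u1 ^ 2 / q ^ 2))
      = / (p ^ 2 * q ^ 2)).
  { transitivity ((u1 ^ 2 + u2 ^ 2) ^ 2 / (p ^ 2 * q ^ 2)).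
    - unfold det; cbn [xx xy yy]; field; lra.
    - rewrite Hu; field; lra. }
  split.
  - apply posdef_of_value with (v := (u1, u2)).
    + rewrite Hd; apply Rinv_0_lt_compat, Rmult_lt_0_compat; apply pow_lt; assumption.
    + replace (bil _ _ _) with ((u1 ^ 2 + u2 ^ 2) ^ 2 / p ^ 2)
        by (unfold bil; cbn [xx xy yy fst snd]; field; lra).
      rewrite Hu; apply Rdiv_lt_0_compat; [lra | apply pow_lt; assumption].
  - apply pset_ext; intro X; unfold ellipse_curve, conic, bil, vec.
    cbn [xx xy yy fst snd].
    match goal with |- ?l = 1 <-> ?r = 1 => replace r with l; [tauto|] end.
    field; lra.
Qed.

(** Diagonalization by a rotation.  When [b <> 0], the larger root [k] of the
    characteristic polynomial has eigenvector [(b, k - a)]. *)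
Lemma orthonormal_diagonalization (m : form) :
  posdef m -> exists u1 u2 k l : R,
    u1 ^ 2 + u2 ^ 2 = 1 /\ 0 < k /\ 0 < l /\
    m = Form (k * u1 ^ 2 + l * u2 ^ 2) ((k - l) * (u1 * u2)) (k * u2 ^ 2 + l * u1 ^ 2).
Proof.
  destruct m as [a b c]; unfold posdef, det; cbn [xx xy yy]; intros [Ha Hd].
  destruct (Req_dec b 0) as [Hb|Hb].
  - subst b; exists 1, 0, a, c.
    assert (0 < c) by nra.
    repeat split; try lra; f_equal; ring.
  - set (r := sqrt ((a - c) ^ 2 + 4 * b ^ 2)).
    assert (Hb2 : 0 < b ^ 2) by (apply pow2_gt_0; exact Hb).
    assert (Hr2 : r * r = (a - c) ^ 2 + 4 * b ^ 2).
    { apply sqrt_sqrt; assert (0 <= (a - c) ^ 2) by apply pow2_ge_0; lra. }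
    assert (Hr : 0 <= r) by apply sqrt_pos.
    assert (Hc : 0 < c) by nra.
    set (k := (a + c + r) / 2).
    set (l := a + c - k).
    assert (Hchar : (k - a) * (k - c) = b ^ 2).
    { unfold k; transitivity ((r * r - (a - c) ^ 2) / 4); [field|].
      rewrite Hr2; field. }
    assert (Hk : 0 < k) by (unfold k; lra).
    assert (Hkl : k * l = a * c - b ^ 2).
    { unfold l; rewrite <- Hchar; ring. }
    assert (Hl : 0 < l).
    { apply Rmult_lt_reg_l with k; [exact Hk|]; rewrite Hkl; lra. }
    set (N := b ^ 2 + (k - a) ^ 2).
    assert (HN : 0 < N).
    { unfold N; assert (0 <= (k - a) ^ 2) by apply pow2_ge_0; lra. }
    set (s := sqrt N).
    assert (Hs : s ^ 2 = N) by (unfold s; rewrite <- Rsqr_pow2; apply Rsqr_sqrt; lra).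
    assert (Hs0 : 0 < s) by (apply sqrt_lt_R0; exact HN).
    exists (b / s), ((k - a) / s), k, l.
    assert (E1 : (b / s) ^ 2 = b ^ 2 / N) by (rewrite <- Hs; field; lra).
    assert (E2 : ((k - a) / s) ^ 2 = (k - a) ^ 2 / N) by (rewrite <- Hs; field; lra).
    assert (E3 : b / s * ((k - a) / s) = b * (k - a) / N)
      by (rewrite <- Hs; field; lra).
    rewrite E1, E2, E3.
    assert (Cancel : forall x y, y = x * N -> x = y / N)
      by (intros x y ->; field; lra).
    repeat split; try assumption.
    + transitivity (N / N); [unfold N; field; fold N; lra | field; lra].
    + f_equal.
      * transitivity ((k * b ^ 2 + l * (k - a) ^ 2) / N); [apply Cancel | field; lra].
        unfold l, N; rewrite <- Hchar; ring.
      * transitivity ((k - l) * (b * (k - a)) / N); [apply Cancel | field; lra].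
        unfold l, N; rewrite <- Hchar; ring.
      * transitivity ((k * (k - a) ^ 2 + l * b ^ 2) / N); [apply Cancel | field; lra].
        unfold l, N; rewrite <- Hchar; ring.
Qed.

Lemma ellipse_of_conic (O : point) (m : form) :
  posdef m -> ellipse_with_center O (conic m O).
Proof.
  intro Hm.
  destruct (orthonormal_diagonalization m Hm) as (u1 & u2 & k & l & Hu & Hk & Hl & ->).
  exists u1, u2, (/ sqrt k), (/ sqrt l).
  repeat split; try assumption; try (apply Rinv_0_lt_compat, sqrt_lt_R0; assumption).
  apply pset_ext; intro X; unfold ellipse_curve, conic, bil, vec.
  cbn [xx xy yy fst snd].
  assert (Inv : forall z x, 0 < z -> x / (/ sqrt z) ^ 2 = z * x).
  { intros z x Hz; rewrite pow_inv, pow2_sqrt by lra; field; lra. }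
  rewrite !Inv by assumption.
  match goal with |- ?l = 1 <-> ?r = 1 => replace r with l; [tauto|ring] end.
Qed.

(** * Tangency to a side *)

Lemma tangent_vector_orthogonal (m : form) (O T v : point) :
  tangent_vector (conic m O) T v -> bil m (vec O T) v = 0.
Proof.
  intros (g & Hg0 & Hloc & H1 & H2); subst T.
  set (f := fun t => bil m (vec O (g t)) (vec O (g t))).
  assert (D : is_derive f 0 (2 * bil m (vec O (g 0)) v)).
  { unfold f, bil, vec; cbn [fst snd].
    set (g1 := fun t => fst (g t)); set (g2 := fun t => snd (g t)).
    change (is_derive g1 0 (fst v)) in H1; change (is_derive g2 0 (snd v)) in H2.
    change (is_derive (fun t => xx m * (g1 t - fst O) * (g1 t - fst O)
      + xy m * ((g1 t - fst O) * (g2 t - snd O) + (g2 t - snd O) * (g1 t - fst O))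
      + yy m * (g2 t - snd O) * (g2 t - snd O)) 0
      (2 * (xx m * (g1 0 - fst O) * fst v
            + xy m * ((g1 0 - fst O) * snd v + (g2 0 - snd O) * fst v)
            + yy m * (g2 0 - snd O) * snd v))).
    assert (X1 : ex_derive g1 0) by (eexists; exact H1).
    assert (X2 : ex_derive g2 0) by (eexists; exact H2).
    clearbody g1 g2; auto_derive; [tauto|].
    change (fun x => g1 x) with g1; change (fun x => g2 x) with g2.
    rewrite (is_derive_unique _ _ _ H1), (is_derive_unique _ _ _ H2); ring. }
  assert (D0 : is_derive f 0 0).
  { apply is_derive_ext_loc with (f := fun _ => 1).
    - apply filter_imp with (2 := Hloc); intros t Ht; symmetry; exact Ht.
    - exact (is_derive_const 1 0). }
  assert (E := is_derive_unique _ _ _ D); rewrite (is_derive_unique _ _ _ D0) in E.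
  lra.
Qed.

Lemma dual_of_tangent (m : form) (O P Q : point) :
  posdef m -> tangent_to_side (conic m O) P Q ->
  bil (dual m) (vec P Q) (vec P Q) = orient P Q O ^ 2.
Proof.
  intros [_ Hd] (T & (t & _ & HT) & HE & Hv).
  apply tangent_vector_orthogonal in Hv; fold (vec P Q) in Hv.
  assert (L := lagrange_identity m (vec O T) (vec P Q)).
  unfold conic in HE; rewrite HE, Hv in L.
  (* [T] lies on the line [PQ], so [T] and [P] have the same cross product. *)
  assert (C : cross (vec O T) (vec P Q) = orient P Q O).
  { subst T; unfold cross, orient, vec; cbn; ring. }
  rewrite C in L; rewrite bil_dual.
  apply Rmult_eq_reg_r with (det m); [|lra].
  replace (bil m (vec P Q) (vec P Q) / det m * det m)
    with (bil m (vec P Q) (vec P Q)) by (field; lra).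
  lra.
Qed.

(** Through a point [T] of the ellipse, [cos T + sin v] runs along the ellipse when
    [v] is conjugate to [T]; rescaling time gives it the velocity [v]. *)
Lemma tangent_vector_of_conjugate (m : form) (O T v : point) :
  0 < bil m v v -> conic m O T -> bil m (vec O T) v = 0 ->
  tangent_vector (conic m O) T v.
Proof.
  intros Hv HT Hc.
  set (w := sqrt (bil m v v)).
  assert (Hw : 0 < w) by (apply sqrt_lt_R0; exact Hv).
  assert (Hw2 : w * w = bil m v v) by (apply sqrt_sqrt; lra).
  exists (fun t => (fst O + cos (w * t) * fst (vec O T) + sin (w * t) / w * fst v,
                    snd O + cos (w * t) * snd (vec O T) + sin (w * t) / w * snd v)).
  split; [|split; [|split]].
  - rewrite Rmult_0_r, cos_0, sin_0; destruct T as [T1 T2]; unfold vec; cbn.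
    f_equal; field; lra.
  - apply filter_forall; intro t; unfold conic.
    assert (SC := sin2_cos2 (w * t)); unfold Rsqr in SC.
    set (sn := sin (w * t)) in *; set (cs := cos (w * t)) in *.
    transitivity (cs * cs * bil m (vec O T) (vec O T)
                  + 2 * cs * (sn / w) * bil m (vec O T) v
                  + sn / w * (sn / w) * bil m v v).
    + unfold bil, vec; cbn [fst snd]; ring.
    + rewrite HT, Hc, <- Hw2.
      transitivity (sn * sn + cs * cs); [field; lra | exact SC].
  - cbn [fst]; auto_derive; [trivial|].
    rewrite Rmult_0_r, cos_0, sin_0; field; lra.
  - cbn [snd]; auto_derive; [trivial|].
    rewrite Rmult_0_r, cos_0, sin_0; field; lra.
Qed.

Definition point_on (P Q : point) (t : R) : point :=
  ((1 - t) * fst P + t * fst Q, (1 - t) * snd P + t * snd Q).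

(** The point of tangency is where the form attains its minimum on the line. *)
Lemma tangent_of_dual (m : form) (O P Q : point) :
  posdef m -> P <> Q ->
  bil (dual m) (vec P Q) (vec P Q) = orient P Q O ^ 2 ->
  exists t, conic m O (point_on P Q t) /\
    tangent_vector (conic m O) (point_on P Q t) (vec P Q).
Proof.
  intros Hm HPQ Hdual.
  assert (Hv : vec P Q <> (0, 0)).
  { intro E; apply HPQ; destruct P, Q; unfold vec in E; cbn in E.
    injection E; intros; f_equal; lra. }
  assert (Hpos := bil_pos m _ Hm Hv).
  set (t := - bil m (vec O P) (vec P Q) / bil m (vec P Q) (vec P Q)).
  exists t; set (T := point_on P Q t).
  assert (Hconj : bil m (vec O T) (vec P Q) = 0).
  { transitivity (bil m (vec O P) (vec P Q) + t * bil m (vec P Q) (vec P Q)).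
    - unfold T, point_on, bil, vec; cbn [fst snd]; ring.
    - unfold t; field; lra. }
  assert (HT : conic m O T).
  { assert (L := lagrange_identity m (vec O T) (vec P Q)).
    assert (C : cross (vec O T) (vec P Q) = orient P Q O)
      by (unfold T, point_on, cross, orient, vec; cbn; ring).
    rewrite Hconj, C, <- Hdual, bil_dual in L.
    destruct Hm as [_ Hd].
    unfold conic; apply Rmult_eq_reg_r with (bil m (vec P Q) (vec P Q)); [|lra].
    replace (det m * (bil m (vec P Q) (vec P Q) / det m))
      with (bil m (vec P Q) (vec P Q)) in L by (field; lra).
    lra. }
  split; [exact HT | apply tangent_vector_of_conjugate; assumption].
Qed.

Lemma pos_of_mul_common (x y z : R) : 0 < x * y -> 0 < y * z -> 0 < x * z.
Proof.
  intros Hxy Hyz.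
  assert (Hy : y <> 0) by (intro; subst; lra).
  apply Rmult_lt_reg_r with (y ^ 2); [apply pow2_gt_0; exact Hy|].
  replace (x * z * y ^ 2) with (x * y * (y * z)) by ring.
  rewrite Rmult_0_l; apply Rmult_lt_0_compat; assumption.
Qed.

(** An ellipse stays within the strip between a tangent line and the parallel
    tangent line on the other side of its center. *)
Lemma conic_same_side (m : form) (O P Q V X : point) :
  posdef m -> bil (dual m) (vec P Q) (vec P Q) = orient P Q O ^ 2 ->
  strictly_same_side P Q V O -> conic m O X ->
  0 <= orient P Q V * orient P Q X.
Proof.
  intros [_ Hd] Hdual HV HX; unfold strictly_same_side in HV.
  assert (L := lagrange_identity m (vec O X) (vec P Q)).
  unfold conic in HX; rewrite HX in L.
  assert (C : cross (vec O X) (vec P Q) = orient P Q O - orient P Q X)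
    by (unfold cross, orient, vec; cbn; ring).
  rewrite C in L; rewrite bil_dual in Hdual.
  set (o := orient P Q O) in *; set (x := orient P Q X) in *.
  set (y := orient P Q V) in *.
  assert (Hstrip : (o - x) ^ 2 <= o ^ 2).
  { apply Rmult_le_reg_l with (det m); [exact Hd|].
    rewrite <- Hdual, <- L.
    replace (det m * (bil m (vec P Q) (vec P Q) / det m))
      with (bil m (vec P Q) (vec P Q)) by (field; lra).
    assert (0 <= bil m (vec O X) (vec P Q) ^ 2) by apply pow2_ge_0; lra. }
  assert (Hox : 0 <= o * x).
  { assert (0 <= x ^ 2) by apply pow2_ge_0; nra. }
  assert (Ho : o <> 0) by (intro E; rewrite E in HV; lra).
  apply Rmult_le_reg_r with (o ^ 2); [apply pow2_gt_0; exact Ho|].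
  replace (y * x * o ^ 2) with (y * o * (o * x)) by ring.
  rewrite Rmult_0_l; apply Rmult_le_pos; lra.
Qed.

(** * Convex quadrilaterals *)

Lemma convex_triangles (A B C D : point) :
  convex_quadrilateral A B C D ->
  0 < orient A B C * orient D A B /\ 0 < orient B C D * orient A B C /\
  0 < orient C D A * orient B C D /\ 0 < orient D A B * orient C D A.
Proof.
  intros (H1 & H2 & H3 & H4); unfold strictly_same_side in *.
  assert (R1 : orient A B D = orient D A B) by (unfold orient; ring).
  assert (R2 : orient B C A = orient A B C) by (unfold orient; ring).
  assert (R3 : orient C D B = orient B C D) by (unfold orient; ring).
  assert (R4 : orient D A C = orient C D A) by (unfold orient; ring).
  rewrite R1 in H1; rewrite R2 in H2; rewrite R3 in H3; rewrite R4 in H4.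
  tauto.
Qed.

Lemma convex_rotate (A B C D : point) :
  convex_quadrilateral A B C D -> convex_quadrilateral B C D A.
Proof.
  intros (H1 & H2 & H3 & H4); repeat split; assumption.
Qed.

Lemma convex_cross (A B C D : point) :
  convex_quadrilateral A B C D -> cross (vec A B) (vec B C) <> 0.
Proof.
  intros HR E; apply convex_triangles in HR.
  replace (orient A B C) with (cross (vec A B) (vec B C)) in HR
    by (unfold cross, orient, vec; cbn; ring).
  rewrite E in HR; lra.
Qed.

Lemma convex_neq (A B C D : point) : convex_quadrilateral A B C D -> A <> B.
Proof.
  intros HR ->; apply (convex_cross _ _ _ _ HR); unfold cross, vec; cbn; ring.
Qed.

(** Barycentric coordinates with respect to a triangle are ratios of areas. *)
Lemma barycentric (A B C X : point) :
  orient A B C <> 0 ->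
  X = (orient B C X / orient A B C * fst A + orient C A X / orient A B C * fst B
         + orient A B X / orient A B C * fst C,
       orient B C X / orient A B C * snd A + orient C A X / orient A B C * snd B
         + orient A B X / orient A B C * snd C).
Proof.
  destruct A as [a1 a2], B as [b1 b2], C as [c1 c2], X as [x1 x2].
  unfold orient; cbn; intro H; f_equal; field; exact H.
Qed.

Lemma barycentric_sum (A B C X : point) :
  orient A B C <> 0 ->
  orient B C X / orient A B C + orient C A X / orient A B C
    + orient A B X / orient A B C = 1.
Proof. unfold orient; intro H; field; exact H. Qed.

Lemma div_nonneg_of_mul (x y : R) : y <> 0 -> 0 <= y * x -> 0 <= x / y.
Proof.
  intros Hy H; replace (x / y) with (y * x * / y ^ 2) by (field; exact Hy).
  apply Rmult_le_pos; [exact H|].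
  left; apply Rinv_0_lt_compat, pow2_gt_0, Hy.
Qed.

Lemma nonneg_of_mul_common (x y z : R) : 0 < x * y -> 0 <= y * z -> 0 <= x * z.
Proof.
  intros Hxy Hyz.
  assert (Hy : y <> 0) by (intro; subst; lra).
  apply Rmult_le_reg_r with (y ^ 2); [apply pow2_gt_0; exact Hy|].
  replace (x * z * y ^ 2) with (x * y * (y * z)) by ring.
  rewrite Rmult_0_l; apply Rmult_le_pos; lra.
Qed.

(** The diagonal [AC] cuts the quadrilateral into the triangles [ABC] and [CDA]. *)
Lemma hull4_of_same_sides (A B C D X : point) :
  convex_quadrilateral A B C D ->
  0 <= orient A B C * orient A B X -> 0 <= orient B C D * orient B C X ->
  0 <= orient C D A * orient C D X -> 0 <= orient D A B * orient D A X ->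
  hull4 A B C D X.
Proof.
  intros HR H1 H2 H3 H4.
  destruct (convex_triangles _ _ _ _ HR) as (P1 & P2 & P3 & P4).
  assert (NB : orient A B C <> 0) by (intro E; rewrite E in P1; lra).
  assert (ND : orient C D A <> 0) by (intro E; rewrite E in P3; lra).
  assert (P5 := pos_of_mul_common _ _ _ P3 P2).
  destruct (Rle_dec 0 (orient A B C * orient C A X)) as [HB|HD].
  - exists (orient B C X / orient A B C), (orient C A X / orient A B C),
           (orient A B X / orient A B C), 0.
    assert (H2' : 0 <= orient A B C * orient B C X).
    { apply nonneg_of_mul_common with (orient B C D); [lra | exact H2]. }
    assert (S := barycentric_sum A B C X NB).
    repeat split; try (apply div_nonneg_of_mul; assumption); try lra.
    rewrite (barycentric A B C X NB) at 1; f_equal; ring.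
  - assert (HAC : 0 <= orient C D A * orient A C X).
    { apply nonneg_of_mul_common with (orient A B C); [exact P5|].
      replace (orient A C X) with (- orient C A X) by (unfold orient; ring); lra. }
    assert (H4' : 0 <= orient C D A * orient D A X).
    { apply nonneg_of_mul_common with (orient D A B); [lra | exact H4]. }
    exists (orient C D X / orient C D A), 0,
           (orient D A X / orient C D A), (orient A C X / orient C D A).
    assert (S := barycentric_sum C D A X ND).
    repeat split; try (apply div_nonneg_of_mul; assumption); try lra.
    rewrite (barycentric C D A X ND) at 1; f_equal; ring.
Qed.

(** On the line [AB], the two neighboring sides cut out the side [AB]. *)
Lemma segment_of_same_sides (A B C D : point) (t : R) :
  convex_quadrilateral A B C D ->
  0 <= orient B C D * orient B C (point_on A B t) ->
  0 <= orient D A B * orient D A (point_on A B t) ->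
  segment A B (point_on A B t).
Proof.
  intros HR H2 H4.
  destruct (convex_triangles _ _ _ _ HR) as (P1 & P2 & P3 & P4).
  replace (orient B C (point_on A B t)) with ((1 - t) * orient A B C) in H2
    by (unfold orient, point_on; cbn; ring).
  replace (orient D A (point_on A B t)) with (t * orient D A B) in H4
    by (unfold orient, point_on; cbn; ring).
  exists t; split; [|reflexivity]; split.
  - apply Rmult_le_reg_r with (orient D A B ^ 2).
    + apply pow2_gt_0; intro E; rewrite E in P4; lra.
    + rewrite Rmult_0_l.
      replace (t * orient D A B ^ 2) with (orient D A B * (t * orient D A B)) by ring.
      exact H4.
  - cut (0 <= 1 - t); [lra|].
    apply Rmult_le_reg_r with (orient B C D * orient A B C); [exact P2|].
    rewrite Rmult_0_l.
    replace ((1 - t) * (orient B C D * orient A B C))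
      with (orient B C D * ((1 - t) * orient A B C)) by ring.
    exact H2.
Qed.

(** Opposite sides that are parallel in both pairs make a parallelogram, whose
    diagonals bisect each other. *)
Lemma parallelogram_midpoints (A B C D : point) :
  convex_quadrilateral A B C D ->
  cross (vec A B) (vec C D) = 0 -> cross (vec B C) (vec D A) = 0 ->
  midpoint A C = midpoint B D.
Proof.
  intros HR H1 H2; assert (HN := convex_cross _ _ _ _ HR).
  destruct A as [a1 a2], B as [b1 b2], C as [c1 c2], D as [d1 d2].
  unfold cross, vec, midpoint in *; cbn in *.
  set (n := (b1 - a1) * (c2 - b2) - (b2 - a2) * (c1 - b1)) in *.
  (* [AB + CD] is parallel to [AB] and, being [- (BC + DA)], also to [BC]. *)
  assert (Z1 : n * (b1 - a1 + (d1 - c1)) = 0).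
  { transitivity (((c1 - b1) * (a2 - d2) - (c2 - b2) * (a1 - d1)) * (b1 - a1)
                  + ((b1 - a1) * (d2 - c2) - (b2 - a2) * (d1 - c1)) * (c1 - b1)).
    - unfold n; ring.
    - rewrite H1, H2; ring. }
  assert (Z2 : n * (b2 - a2 + (d2 - c2)) = 0).
  { transitivity (((c1 - b1) * (a2 - d2) - (c2 - b2) * (a1 - d1)) * (b2 - a2)
                  + ((b1 - a1) * (d2 - c2) - (b2 - a2) * (d1 - c1)) * (c2 - b2)).
    - unfold n; ring.
    - rewrite H1, H2; ring. }
  apply Rmult_integral in Z1, Z2.
  f_equal; lra.
Qed.

Lemma form_eq_on_sides (m n : form) (A B C D : point) :
  convex_quadrilateral A B C D -> midpoint A C <> midpoint B D ->
  bil m (vec A B) (vec A B) = bil n (vec A B) (vec A B) ->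
  bil m (vec B C) (vec B C) = bil n (vec B C) (vec B C) ->
  bil m (vec C D) (vec C D) = bil n (vec C D) (vec C D) ->
  bil m (vec D A) (vec D A) = bil n (vec D A) (vec D A) ->
  m = n.
Proof.
  intros HR HM E1 E2 E3 E4.
  assert (HR2 := convex_rotate _ _ _ _ HR).
  assert (HR3 := convex_rotate _ _ _ _ HR2).
  assert (N1 := convex_cross _ _ _ _ HR).
  assert (N2 := convex_cross _ _ _ _ HR2).
  assert (N3 := convex_cross _ _ _ _ HR3).
  destruct (Req_dec (cross (vec A B) (vec C D)) 0) as [P1|P1].
  - destruct (Req_dec (cross (vec B C) (vec D A)) 0) as [P2|P2].
    + destruct HM; apply parallelogram_midpoints; assumption.
    + apply form_eq_on_three with (4 := E2) (5 := E3) (6 := E4); assumption.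
  - apply form_eq_on_three with (4 := E1) (5 := E2) (6 := E3); assumption.
Qed.

(** * The pencil of dual conics tangent to the sides *)

(** The member with weights [1 - t] and [t] of the pencil spanned by the pairs of
    opposite vertices, read as a form in the direction of the line; [bil_pencil]
    is its closed form. *)
Definition pencil (O A B C D : point) (t : R) : form :=
  let a := vec O A in let b := vec O B in let c := vec O C in let d := vec O D in
  Form (- (1 - t) * (snd a * snd c) - t * (snd b * snd d))
       ((1 - t) * ((fst a * snd c + snd a * fst c) / 2)
        + t * ((fst b * snd d + snd b * fst d) / 2))
       (- (1 - t) * (fst a * fst c) - t * (fst b * fst d)).

Lemma bil_pencil (O A B C D v : point) (t : R) :
  bil (pencil O A B C D t) v v
  = - (1 - t) * (cross v (vec O A) * cross v (vec O C))
    - t * (cross v (vec O B) * cross v (vec O D)).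
Proof. unfold bil, pencil, cross; cbn; field. Qed.

Definition newton_point (A B C D : point) (t : R) : point :=
  point_on (midpoint A C) (midpoint B D) t.

(** The side line passes through one point of each pair of opposite vertices, so
    both terms of the form have the factor [orient A B O]; the choice of [O] makes
    the cofactor equal to [orient A B O] as well. *)
Lemma pencil_side (A B C D : point) (t : R) :
  bil (pencil (newton_point A B C D t) A B C D t) (vec A B) (vec A B)
  = orient A B (newton_point A B C D t) ^ 2.
Proof.
  rewrite bil_pencil.
  unfold newton_point, point_on, midpoint, cross, orient, vec; cbn; field.
Qed.

Lemma pencil_rotate (O A B C D : point) (t : R) :
  pencil O B C D A (1 - t) = pencil O A B C D t.
Proof. unfold pencil; cbn; f_equal; field. Qed.

Lemma newton_point_rotate (A B C D : point) (t : R) :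
  newton_point B C D A (1 - t) = newton_point A B C D t.
Proof. unfold newton_point, point_on, midpoint; cbn; f_equal; field. Qed.

Lemma det_pencil (A B C D : point) (t : R) :
  det (pencil (newton_point A B C D t) A B C D t)
  = (1 - t) * t / 4 * (t * (orient B C D * orient D A B)
                       + (1 - t) * (orient A B C * orient C D A)).
Proof.
  unfold det, pencil, newton_point, point_on, midpoint, orient, vec; cbn; field.
Qed.

(** [A] and [B] have height zero above the line [AB], so the height of the point is
    a combination of those of [C] and [D] with positive weights. *)
Lemma newton_point_inside (A B C D : point) (t : R) :
  convex_quadrilateral A B C D -> 0 < t < 1 ->
  strictly_same_side A B C (newton_point A B C D t).
Proof.
  intros (H & _) Ht; unfold strictly_same_side in *.
  replace (orient A B (newton_point A B C D t))
    with ((1 - t) / 2 * orient A B C + t / 2 * orient A B D)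
    by (unfold newton_point, point_on, midpoint, orient; cbn; field).
  assert (0 <= orient A B C * orient A B C) by nra.
  assert (0 < t / 2 * (orient A B C * orient A B D)) by (apply Rmult_lt_0_compat; lra).
  assert (0 <= (1 - t) / 2 * (orient A B C * orient A B C))
    by (apply Rmult_le_pos; lra).
  lra.
Qed.

Lemma posdef_pencil (A B C D : point) (t : R) :
  convex_quadrilateral A B C D -> 0 < t < 1 ->
  posdef (pencil (newton_point A B C D t) A B C D t).
Proof.
  intros HR Ht.
  destruct (convex_triangles _ _ _ _ HR) as (P1 & P2 & P3 & P4).
  apply posdef_of_value with (v := vec A B).
  - rewrite det_pencil.
    assert (Q1 := pos_of_mul_common _ _ _ P2 P1).
    assert (Q2 := pos_of_mul_common _ _ _ P1 P4).
    assert (0 < (1 - t) * t / 4)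
      by (apply Rdiv_lt_0_compat; [apply Rmult_lt_0_compat|]; lra).
    apply Rmult_lt_0_compat; [assumption|].
    apply Rplus_lt_0_compat; (apply Rmult_lt_0_compat; [lra | assumption]).
  - rewrite pencil_side; apply pow2_gt_0; intro E.
    assert (H := newton_point_inside _ _ _ _ _ HR Ht).
    unfold strictly_same_side in H; rewrite E in H; lra.
Qed.

(** * Inscribed ellipses *)

Definition dual_tangent (m : form) (O P Q : point) : Prop :=
  bil (dual m) (vec P Q) (vec P Q) = orient P Q O ^ 2.

Lemma dual_tangent_pencil (m : form) (A B C D : point) (t : R) :
  dual m = pencil (newton_point A B C D t) A B C D t ->
  dual_tangent m (newton_point A B C D t) A B /\
  dual_tangent m (newton_point A B C D t) B C /\
  dual_tangent m (newton_point A B C D t) C D /\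
  dual_tangent m (newton_point A B C D t) D A.
Proof.
  assert (Side : forall A B C D t,
    dual m = pencil (newton_point A B C D t) A B C D t ->
    dual_tangent m (newton_point A B C D t) A B).
  { intros A' B' C' D' t' E; unfold dual_tangent; rewrite E; apply pencil_side. }
  assert (Rot : forall A B C D t,
    dual m = pencil (newton_point A B C D t) A B C D t ->
    dual m = pencil (newton_point B C D A (1 - t)) B C D A (1 - t)).
  { intros A' B' C' D' t' E; rewrite newton_point_rotate, pencil_rotate; exact E. }
  intro E1; assert (E2 := Rot _ _ _ _ _ E1); assert (E3 := Rot _ _ _ _ _ E2).
  assert (E4 := Rot _ _ _ _ _ E3).
  apply Side in E1, E2, E3, E4.
  rewrite !newton_point_rotate in E4; rewrite !newton_point_rotate in E3.
  rewrite newton_point_rotate in E2.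
  tauto.
Qed.

Lemma inscribed_of_dual (m : form) (O A B C D : point) :
  convex_quadrilateral A B C D -> posdef m ->
  strictly_same_side A B C O -> strictly_same_side B C D O ->
  strictly_same_side C D A O -> strictly_same_side D A B O ->
  dual_tangent m O A B -> dual_tangent m O B C ->
  dual_tangent m O C D -> dual_tangent m O D A ->
  inscribed (conic m O) A B C D.
Proof.
  intros HR Hm S1 S2 S3 S4 T1 T2 T3 T4.
  assert (Side : forall A B C D, convex_quadrilateral A B C D ->
    strictly_same_side B C D O -> strictly_same_side D A B O ->
    dual_tangent m O A B -> dual_tangent m O B C -> dual_tangent m O D A ->
    tangent_to_side (conic m O) A B).
  { clear - Hm; intros A B C D HR S2 S4 T1 T2 T4.
    destruct (tangent_of_dual m O A B Hm (convex_neq _ _ _ _ HR) T1)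
      as (t & HT & Hv).
    exists (point_on A B t); split; [|split; assumption].
    apply segment_of_same_sides with C D; [exact HR| |];
      eapply conic_same_side; eassumption. }
  assert (HR2 := convex_rotate _ _ _ _ HR).
  assert (HR3 := convex_rotate _ _ _ _ HR2).
  assert (HR4 := convex_rotate _ _ _ _ HR3).
  split.
  - intros X HX; apply hull4_of_same_sides; [exact HR| | | |];
      eapply conic_same_side; eassumption.
  - repeat split; eapply Side; eassumption.
Qed.

Lemma open_segment_parameter (P Q X : point) :
  open_segment P Q X -> P <> Q /\ exists t, 0 < t < 1 /\ X = point_on P Q t.
Proof.
  intros ((t & Ht & ->) & HP & HQ).
  destruct P as [p1 p2], Q as [q1 q2]; cbn [fst snd] in *.
  split.
  - intro E; apply HP; injection E; intros; subst; f_equal; ring.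
  - exists t; split; [|reflexivity].
    assert (t <> 0) by (intro; subst t; apply HP; f_equal; ring).
    assert (t <> 1) by (intro; subst t; apply HQ; f_equal; ring).
    lra.
Qed.

Theorem theorem3 (A B C D : point) (h k : R) :
  convex_quadrilateral A B C D ->
  open_segment (midpoint A C) (midpoint B D) (h, k) ->
  exists! E : pset, ellipse_with_center (h, k) E /\ inscribed E A B C D.
Proof.
  intros HR HO.
  destruct (open_segment_parameter _ _ _ HO) as (HM & t & Ht & ->).
  fold (newton_point A B C D t); set (O := newton_point A B C D t).
  assert (Hpos := posdef_pencil A B C D t HR Ht); fold O in Hpos.
  set (m := dual (pencil O A B C D t)).
  assert (Hm : posdef m) by (apply posdef_dual; exact Hpos).
  assert (Hdual : dual m = pencil O A B C D t)
    by (apply dual_involutive; destruct Hpos; lra).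
  destruct (dual_tangent_pencil m A B C D t Hdual) as (T1 & T2 & T3 & T4).
  fold O in T1, T2, T3, T4.
  exists (conic m O); split.
  - split; [apply ellipse_of_conic; exact Hm|].
    assert (HR2 := convex_rotate _ _ _ _ HR).
    assert (HR3 := convex_rotate _ _ _ _ HR2).
    assert (HR4 := convex_rotate _ _ _ _ HR3).
    assert (S1 := newton_point_inside _ _ _ _ t HR Ht).
    assert (S2 := newton_point_inside _ _ _ _ (1 - t) HR2 ltac:(lra)).
    assert (S3 := newton_point_inside _ _ _ _ (1 - (1 - t)) HR3 ltac:(lra)).
    assert (S4 := newton_point_inside _ _ _ _ (1 - (1 - (1 - t))) HR4 ltac:(lra)).
    rewrite !newton_point_rotate in S4; rewrite !newton_point_rotate in S3.
    rewrite newton_point_rotate in S2.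
    apply inscribed_of_dual; assumption.
  - intros E [HE (_ & I1 & I2 & I3 & I4)].
    destruct (conic_of_ellipse _ _ HE) as (n & Hn & ->).
    apply dual_of_tangent in I1, I2, I3, I4; try exact Hn.
    assert (Edual : dual m = dual n).
    { apply form_eq_on_sides with A B C D; try assumption; congruence. }
    f_equal.
    rewrite <- (dual_involutive m) by (destruct Hm; lra).
    rewrite <- (dual_involutive n) by (destruct Hn; lra).
    rewrite Edual; reflexivity.
Qed.
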